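(* Let $\Gamma$ be a semigroup acting minimally by homeomorphisms of a compact metric space $X$, and let $A:\Gamma\times X\to \mathrm{GL}(n,\mathbb{R})$ be a continuous map satisfying $A(fg,x)=A(f,g(x))A(g,x)$ for all $x\in X$ and all $f,g\in\Gamma$. Assume that there is a point $x_0\in X$ and a constant $C>0$ such that for all $f\in\Gamma$, $$\max\{\|A(f,x_0)\|,\|A(f,x_0)^{-1}\|\}\le C.$$ Then $A$ is cohomologous to a cocycle $\tilde A:\Gamma\times X\to \mathrm{O}(n,\mathbb{R})$; that is, there is a continuous map $B:X\to\mathrm{GL}(n,\mathbb{R})$ such that $$B(f(x))^{-1}A(f,x)B(x)=\tilde A(f,x)\in \mathrm{O}(n,\mathbb{R})\qquad\text{for all } x\in X,\ f\in\Gamma.$$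
   Context: The action is minimal if every orbit $\{f(x):f\in\Gamma\}$, $x\in X$, is dense in $X$. Continuity of $A$ means that $A(f,\cdot):X\to \mathrm{GL}(n,\mathbb{R})$ is continuous for each $f\in\Gamma$ ($\Gamma$ is regarded as discrete). $\|\cdot\|$ is the operator norm of matrices. *)

(* Defs.v *)
From HB Require Import structures.
From mathcomp Require Export all_boot all_order all_algebra.
From mathcomp Require Export boolp classical_sets reals topology normedtype.

Set Implicit Arguments.
Unset Strict Implicit.
Unset Printing Implicit Defensive.

Import Order.TTheory GRing.Theory Num.Theory.
Import numFieldNormedType.Exports.

Local Open Scope classical_set_scope.
Local Open Scope ring_scope.

Definition homeomorphism (X Y : topologicalType) (h : X -> Y) : Prop :=
  continuous h /\
  exists k : Y -> X, [/\ cancel h k, cancel k h & continuous k].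

(* A semigroup need not have a unit, so there is no unit axiom. *)
Definition acts_by_homeomorphisms (G : semigroupType) (X : topologicalType)
    (act : G -> X -> X) : Prop :=
  (forall f g x, act (f * g)%g x = act f (act g x)) /\
  (forall f, homeomorphism (act f)).

(* The orbit of x is { f(x) : f in G }; it need not contain x. *)
Definition minimal_action (G : semigroupType) (X : topologicalType)
    (act : G -> X -> X) : Prop :=
  forall x, dense (range (fun f => act f x)).

(* Maps into GL(n, R) are maps into 'M[R]_n whose values lie in [unitmx]:
   GL(n, R) carries the subspace topology, so continuity into GL(n, R) is
   continuity into 'M[R]_n. Continuity in the first variable is vacuous since
   G is discrete. *)
Definition GL_cocycle (R : realType) (n : nat) (G : semigroupType)
    (X : topologicalType) (act : G -> X -> X) (A : G -> X -> 'M[R]_n) : Prop :=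
  [/\ forall f, continuous (A f),
      forall f x, A f x \in unitmx
    & forall f g x, A (f * g)%g x = A f (act g x) *m A g x].

Definition orthogonalmx (R : realType) (n : nat) (M : 'M[R]_n) : Prop :=
  M^T *m M = 1%:M.

Definition cohomologous (R : realType) (n : nat) (G : semigroupType)
    (X : topologicalType) (act : G -> X -> X) (A A' : G -> X -> 'M[R]_n)
    : Prop :=
  exists B : X -> 'M[R]_n,
    [/\ continuous B,
        forall x, B x \in unitmx
      & forall f x, invmx (B (act f x)) *m A f x *m B x = A' f x].

Definition euclidean_norm (R : realType) (n : nat) (v : 'cV[R]_n) : R :=
  Num.sqrt (\sum_(i < n) v i 0 ^+ 2).

(* The library's norm `|M| on matrices is the largest absolute value of an
   entry, so the operator norm has to be defined separately. *)
Definition operator_norm (R : realType) (n : nat) (M : 'M[R]_n) : R :=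
  sup [set euclidean_norm (M *m v) | v in
        [set v : 'cV[R]_n | euclidean_norm v <= 1]].

(* Main.v *)
From mathcomp Require Import realfun interval_inference ring lra.
Require Import Defs.

(* The cocycle acts on positive definite matrices by p |-> A p A^T, and it is
   enough to find a continuous invariant section S of the trivial bundle with
   this fibre: writing S = B B^T by Cholesky, B conjugates A into O(n, R).

   Let K(c) be the set of (x, p) such that p and all its images A(g, x) p
   A(g, x)^T are symmetric, >= Id, and of squared Frobenius norm <= c. It is
   compact, invariant and fibrewise convex, and boundedness over x0 makes it
   nonempty for large c. At the least c for which K(c) is nonempty, its
   projection is X by minimality, and its fibres are singletons: by the
   parallelogram identity the midpoint of two distinct points of a fibre would
   lie in K(c - e). Hence K(c) is the graph of S, which is continuous since
   K(c) is compact. *)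

Set Implicit Arguments.
Unset Strict Implicit.
Unset Printing Implicit Defensive.

Import Order.TTheory GRing.Theory Num.Theory.
Import numFieldNormedType.Exports.

Local Open Scope classical_set_scope.
Local Open Scope ring_scope.

(** * Continuity of matrix-valued maps *)

Lemma closed_preimage (S T : topologicalType) (f : S -> T) (D : set T) :
  continuous f -> closed D -> closed [set x | D (f x)].
Proof. by move=> /continuous_closedP; apply. Qed.

Section Continuity.
Variables (R : realType) (T : topologicalType).

(** A neighbourhood of a matrix contains a product of neighbourhoods of its finitely many
    entries. *)
Lemma mx_continuous m n (f : T -> 'M[R]_(m, n)) :
  (forall i j, continuous (fun x => f x i j)) -> continuous f.
Proof.
move=> fc x U [P P_fx PU].
have : \forall y \near x, forall i j, P i j (f y i j).
  apply: filter_forall => i; apply: filter_forall => j.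
  exact: (fc i j x _ (P_fx i j)).
by apply: filterS => y Py; apply: PU.
Qed.

Lemma continuous_coord m n (f : T -> 'M[R]_(m, n)) i j :
  continuous f -> continuous (fun x => f x i j).
Proof.
move=> fc x.
exact: (continuous_comp (fc x) (@coord_continuous _ _ _ i j (f x))).
Qed.

Lemma continuous_sumr (I : finType) (f : I -> T -> R) :
  (forall i, continuous (f i)) -> continuous (fun x => \sum_i f i x).
Proof.
move=> fc; apply: continuous_big => // -[a b].
by apply: cvgD; [exact: cvg_fst|exact: cvg_snd].
Qed.

Lemma continuous_mulmx m n p (f : T -> 'M[R]_(m, n)) (g : T -> 'M[R]_(n, p)) :
  continuous f -> continuous g -> continuous (fun x => f x *m g x).
Proof.
move=> fc gc; apply: mx_continuous => i j.
under eq_fun do rewrite mxE.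
apply: continuous_sumr => k x.
by apply: cvgM; apply: continuous_coord.
Qed.

Lemma continuous_trmx m n (f : T -> 'M[R]_(m, n)) :
  continuous f -> continuous (fun x => (f x)^T).
Proof.
move=> fc; apply: mx_continuous => i j.
by under eq_fun do rewrite mxE; apply: continuous_coord.
Qed.

Lemma continuous_block_mx m1 m2 n1 n2 (f : T -> 'M[R]_(m1, n1))
    (g : T -> 'M[R]_(m1, n2)) (h : T -> 'M[R]_(m2, n1))
    (k : T -> 'M[R]_(m2, n2)) :
  continuous f -> continuous g -> continuous h -> continuous k ->
  continuous (fun x => block_mx (f x) (g x) (h x) (k x)).
Proof.
move=> fc gc hc kc; apply: mx_continuous => i j.
case: (fintype.split_ordP i) => i' ->; case: (fintype.split_ordP j) => j' ->.
- by under eq_fun do rewrite block_mxEul; apply: continuous_coord.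
- by under eq_fun do rewrite block_mxEur; apply: continuous_coord.
- by under eq_fun do rewrite block_mxEdl; apply: continuous_coord.
- by under eq_fun do rewrite block_mxEdr; apply: continuous_coord.
Qed.

Lemma continuous_scalemx m n (a : T -> R) (f : T -> 'M[R]_(m, n)) :
  continuous a -> continuous f -> continuous (fun x => a x *: f x).
Proof.
move=> ac fc; apply: mx_continuous => i j.
under eq_fun do rewrite mxE.
by move=> x; apply: cvgM; [exact: ac|apply: continuous_coord].
Qed.

Lemma continuous_oppmx m n (f : T -> 'M[R]_(m, n)) :
  continuous f -> continuous (fun x => - f x).
Proof.
move=> fc; apply: mx_continuous => i j.
under eq_fun do rewrite mxE.
by move=> x; apply: cvgN; apply: continuous_coord.
Qed.

Lemma continuous_addmx m n (f g : T -> 'M[R]_(m, n)) :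
  continuous f -> continuous g -> continuous (fun x => f x + g x).
Proof.
move=> fc gc; apply: mx_continuous => i j.
under eq_fun do rewrite mxE.
by move=> x; apply: cvgD; apply: continuous_coord.
Qed.

Lemma continuous_scalar_mx n (a : T -> R) :
  continuous a -> continuous (fun x => (a x)%:M : 'M[R]_n).
Proof.
move=> ac; under eq_fun do rewrite -scalemx1.
by apply: continuous_scalemx => // x; apply: cvg_cst.
Qed.

End Continuity.

(** * The squared Frobenius norm *)

Section Frobenius.
Variable R : realType.

Definition frob m n (M : 'M[R]_(m, n)) : R := \sum_i \sum_j M i j ^+ 2.

Lemma frob_ge0 m n (M : 'M[R]_(m, n)) : 0 <= frob M.
Proof. by apply: sumr_ge0 => i _; apply: sumr_ge0 => j _; apply: sqr_ge0. Qed.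

Lemma frob_coord m n (M : 'M[R]_(m, n)) i j : M i j ^+ 2 <= frob M.
Proof.
rewrite /frob (bigD1 i) //= (bigD1 j) //= -addrA lerDl addr_ge0 //.
  by apply: sumr_ge0 => k _; apply: sqr_ge0.
by apply: sumr_ge0 => k _; apply: sumr_ge0 => l _; apply: sqr_ge0.
Qed.

Lemma frob0 m n : frob (0 : 'M[R]_(m, n)) = 0.
Proof.
by rewrite /frob big1// => i _; rewrite big1// => j _; rewrite mxE expr0n.
Qed.

Lemma frob_eq0 m n (M : 'M[R]_(m, n)) : frob M = 0 -> M = 0.
Proof.
move=> M0; apply/matrixP => i j; rewrite mxE; apply/eqP.
by rewrite -sqrf_eq0 eq_le sqr_ge0 -M0 frob_coord.
Qed.

Lemma frob_tr m n (M : 'M[R]_(m, n)) : frob M^T = frob M.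
Proof.
rewrite /frob exchange_big; apply: eq_bigr => i _.
by apply: eq_bigr => j _; rewrite mxE.
Qed.

Lemma frobZ m n a (M : 'M[R]_(m, n)) : frob (a *: M) = a ^+ 2 * frob M.
Proof.
rewrite /frob mulr_sumr; apply: eq_bigr => i _; rewrite mulr_sumr.
by apply: eq_bigr => j _; rewrite mxE exprMn.
Qed.

Lemma frob1 n : frob (1%:M : 'M[R]_n) = n%:R.
Proof.
rewrite /frob -[RHS]mul1r -[n in RHS]card_ord -sum1_card natr_sum mulr_sumr.
apply: eq_bigr => i _; rewrite (bigD1 i) //= big1.
  by rewrite mxE eqxx addr0 expr1n mulr1.
by move=> j /negbTE ji; rewrite mxE eq_sym ji expr0n.
Qed.

Lemma frob_row m n (M : 'M[R]_(m, n)) : frob M = \sum_i frob (row i M).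
Proof.
apply: eq_bigr => i _; rewrite /frob big_ord1.
by apply: eq_bigr => j _; rewrite mxE.
Qed.

Lemma mulmx_tr_frob n (u : 'rV[R]_n) : (u *m u^T) 0 0 = frob u.
Proof. by rewrite mxE /frob big_ord1; apply: eq_bigr => i _; rewrite mxE. Qed.

(** Parallelogram identity. The last term is the gain that makes the extremal fibres singletons. *)
Lemma frob_midpoint m n (p q : 'M[R]_(m, n)) :
  frob (2^-1 *: (p + q)) = (frob p + frob q) / 2 - frob (p - q) / 4.
Proof.
rewrite /frob -big_split/= !mulr_suml -sumrB; apply: eq_bigr => i _.
rewrite -big_split/= !mulr_suml -sumrB; apply: eq_bigr => j _.
by rewrite !mxE; field.
Qed.

(** By Lagrange's identity: the double sum of squares is twice the defect of the inequality. *)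
Lemma cauchy_schwarz_sum (I : finType) (a b : I -> R) :
  (\sum_i a i * b i) ^+ 2 <= (\sum_i a i ^+ 2) * (\sum_i b i ^+ 2).
Proof.
have : 0 <= \sum_i \sum_j (a i * b j - a j * b i) ^+ 2.
  by apply: sumr_ge0 => i _; apply: sumr_ge0 => j _; apply: sqr_ge0.
suff -> : \sum_i \sum_j (a i * b j - a j * b i) ^+ 2 =
    2 * ((\sum_i a i ^+ 2) * (\sum_i b i ^+ 2) - (\sum_i a i * b i) ^+ 2).
  by rewrite pmulr_rge0// subr_ge0.
have -> : \sum_i \sum_j (a i * b j - a j * b i) ^+ 2 =
    \sum_i \sum_j a i ^+ 2 * b j ^+ 2 + \sum_i \sum_j a j ^+ 2 * b i ^+ 2
    - 2 * \sum_i \sum_j (a i * b i) * (a j * b j).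
  rewrite mulr_sumr -big_split -sumrB/=; apply: eq_bigr => i _.
  rewrite mulr_sumr -big_split -sumrB/=; apply: eq_bigr => j _.
  ring.
rewrite [X in _ + X - _]exchange_big/= -!big_distrlr/=.
ring.
Qed.

Lemma frobM m n p (M : 'M[R]_(m, n)) (N : 'M[R]_(n, p)) :
  frob (M *m N) <= frob M * frob N.
Proof.
rewrite -[frob N]frob_tr /frob big_distrlr/=.
apply: ler_sum => i _; apply: ler_sum => j _.
rewrite mxE.
under [X in _ <= _ * X]eq_bigr do rewrite mxE.
exact: cauchy_schwarz_sum.
Qed.

Lemma continuous_frob m n : continuous (@frob m n).
Proof.
apply: continuous_sumr => i; apply: continuous_sumr => j M.
exact: (cvgM (@coord_continuous _ _ _ i j M) (@coord_continuous _ _ _ i j M)).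
Qed.

Lemma compact_frob_le m n (c : R) :
  compact [set M : 'M[R]_(m, n) | frob M <= c].
Proof.
(* Each entry has square at most [c], hence absolute value at most [1 + c]; this avoids a square
   root. *)
pose b := 1 + c.
have cK : compact [set M : 'M[R]_(m, n) |
    forall i j, `[- b, b]%classic (M i j)].
  rewrite (_ : mkset _ = vec_mx @`
    [set v : 'rV[R]_(m * n) | forall k, `[- b, b]%classic (v ord0 k)]).
    apply: continuous_compact; last first.
      apply: (@rV_compact _ _ (fun=> `[- b, b]%classic)) => _.
      exact: segment_compact.
    apply: continuous_subspaceT; apply: mx_continuous => i j.
    under eq_fun do rewrite mxE.
    exact: coord_continuous.
  apply/seteqP; split=> [M Mb|_ [v vb <-] i j]; last by rewrite mxE.
  exists (mxvec M); last exact: mxvecK.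
  by move=> k; case/mxvec_indexP: k => i j; rewrite mxvecE.
apply: subclosed_compact cK _.
  by have /continuous_closedP/(_ _ (@closed_le _ c)) := @continuous_frob m n.
move=> M /= Mc i j; have := le_trans (frob_coord M i j) Mc.
rewrite in_itv/= /b => h; apply/andP; split; nra.
Qed.

End Frobenius.

(** * Cholesky factorization with continuous parameters *)

Section Cholesky.
Variables (R : realType) (T : topologicalType).

(** Induction on the size: split off the first row and column, with pivot [a], and factor the Schur
    complement [S']. The inverse [C] is built alongside, so that its continuity comes from the same
    block formulas. *)
Lemma continuous_cholesky n (S : T -> 'M[R]_n) :
  continuous S -> (forall x, (S x)^T = S x) ->
  (forall x (u : 'rV_n), u != 0 -> 0 < (u *m S x *m u^T) 0 0) ->
  exists B C : T -> 'M[R]_n, [/\ continuous B, continuous C,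
    forall x, B x *m C x = 1%:M & forall x, B x *m (B x)^T = S x].
Proof.
elim: n S => [|n IHn] S Sc Ssym Spos.
  exists (fun=> 1%:M), (fun=> 1%:M).
  split=> [x|x|x|x]; [exact: cvg_cst|exact: cvg_cst|exact: mulmx1|].
  by rewrite [LHS]flatmx0 [RHS]flatmx0.
(* [n.+1] and [1 + n] are convertible; this typing lets the block operations apply. *)
pose P x : 'M[R]_(1 + n) := S x.
have Pc : continuous P by exact: Sc.
pose a x := S x 0 0; pose v x := dlsubmx (P x); pose D x := drsubmx (P x).
have ac : continuous a by exact: continuous_coord.
have vc : continuous v.
  apply: mx_continuous => i j; rewrite /v /dlsubmx /lsubmx /dsubmx.
  by under eq_fun do rewrite !mxE; apply: continuous_coord.
have Dc : continuous D.
  apply: mx_continuous => i j; rewrite /D /drsubmx /rsubmx /dsubmx.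
  by under eq_fun do rewrite !mxE; apply: continuous_coord.
have PE x : P x = block_mx (a x)%:M (v x)^T (v x) (D x).
  rewrite -[LHS]submxK; congr block_mx.
    rewrite [LHS]mx11_scalar; congr (_%:M).
    by rewrite /a !mxE; congr (S x _ _); apply: val_inj.
  apply/matrixP => i j; rewrite !mxE /P -[in LHS]Ssym mxE.
  by [].
have Ppos x (u : 'rV_(1 + n)) : u != 0 -> 0 < (u *m P x *m u^T) 0 0.
  exact: Spos.
have a_gt0 x : 0 < a x.
  have := Ppos x (row_mx 1 0); rewrite PE mul_row_block tr_row_mx mul_row_col.
  rewrite !mul0mx !addr0 trmx0 mulmx0 addr0 trmx1 mul1mx mulmx1 mxE eqxx mulr1n.
  apply; apply/eqP => /rowP/(_ 0); rewrite mxE; case: splitP => // k _.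
  by rewrite !mxE ord1 eqxx => /eqP; rewrite oner_eq0.
have a_neq0 x : a x != 0 by rewrite gt_eqF.
pose r x := Num.sqrt (a x).
have r_gt0 x : 0 < r x by rewrite sqrtr_gt0.
have r_neq0 x : r x != 0 by rewrite gt_eqF.
have rr x : r x * r x = a x by rewrite -expr2 sqr_sqrtr// ltW.
have rc : continuous r.
  by move=> x; apply: continuous_comp; [exact: ac|exact: sqrt_continuous].
have aVc : continuous (fun x => (a x)^-1).
  by move=> x; apply: cvgV => //; exact: ac.
have rVc : continuous (fun x => (r x)^-1).
  by move=> x; apply: cvgV => //; exact: rc.
pose S' x := D x - (a x)^-1 *: (v x *m (v x)^T).
have [||| L [M [Lc Mc LM LL]]] := IHn S'.
- apply: continuous_addmx => //; apply: continuous_oppmx.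
  apply: continuous_scalemx => //; apply: continuous_mulmx => //.
  exact: continuous_trmx.
- move=> x; rewrite /S' linearB linearZ/= trmx_mul trmxK; congr (_ - _).
  by apply/matrixP => i j; rewrite !mxE /P -[in LHS]Ssym mxE.
(* Completing the square: this [s] kills the first coordinate of [row_mx s u *m P x], so the form of
   [P x] at [row_mx s u] is that of [S' x] at [u]. *)
- move=> x u u0; set s := - (a x)^-1 *: (u *m v x).
  have /(Ppos x) : row_mx s u != 0.
    apply: contraNneq u0 => /(congr1 rsubmx).
    by rewrite row_mxKr => ->; apply/eqP/rowP => i; rewrite !mxE.
  rewrite PE mul_row_block tr_row_mx mul_row_col.
  rewrite mul_mx_scalar scalerA mulrN divff// scaleN1r addNr mul0mx add0r.
  rewrite /S' mulmxBr -scalemxAr.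
  by rewrite /s -scalemxAl scaleNr mulmxA [- _ + _]addrC.
pose B x := block_mx (r x)%:M 0 ((r x)^-1 *: v x) (L x) : 'M[R]_(1 + n).
pose C x := block_mx (r x)^-1%:M 0 (- ((a x)^-1 *: (M x *m v x))) (M x)
  : 'M[R]_(1 + n).
exists B, C; split.
- apply: (@continuous_block_mx _ _ 1 n 1 n (fun x => (r x)%:M)) => //.
    exact: continuous_scalar_mx.
    by move=> x; apply: cvg_cst.
  exact: continuous_scalemx.
- apply: (@continuous_block_mx _ _ 1 n 1 n (fun x => (r x)^-1%:M)) => //.
    exact: continuous_scalar_mx.
    by move=> x; apply: cvg_cst.
  apply: continuous_oppmx; apply: continuous_scalemx => //.
  exact: continuous_mulmx.
- move=> x; rewrite -[LHS]/(B x *m C x) /B /C mulmx_block.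
  rewrite !mul0mx !mulmx0 !addr0 add0r LM.
  rewrite -scalar_mxM divff// mul_mx_scalar scalerA -invfM rr mulmxN.
  rewrite -scalemxAr mulmxA LM mul1mx subrr.
  by rewrite -[RHS]/((1%:M : 'M_(1 + n))) [RHS]scalar_mx_block.
- move=> x; rewrite -[RHS]/(P x) -[LHS]/(B x *m (B x)^T) PE /B.
  rewrite tr_block_mx mulmx_block.
  rewrite !trmx0 !mul0mx !mulmx0 !addr0 LL tr_scalar_mx -scalar_mxM rr.
  rewrite linearZ/= mul_scalar_mx scalerA divff// scale1r.
  rewrite mul_mx_scalar scalerA divff// scale1r.
  by rewrite -scalemxAl -scalemxAr scalerA -invfM rr /S' addrC subrK.
Qed.

End Cholesky.

(** * From the operator norm to the Frobenius norm *)

Section OperatorNorm.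
Variables (R : realType) (n : nat).

Lemma euclidean_normE (v : 'cV[R]_n) : euclidean_norm v = Num.sqrt (frob v).
Proof. by congr Num.sqrt; apply: eq_bigr => i _; rewrite big_ord1. Qed.

(** The supremum bounds its set only if the set is bounded above; the Frobenius norm of [M] is such
    a bound. *)
Lemma euclidean_norm_le_operator_norm (M : 'M[R]_n) (v : 'cV[R]_n) :
  euclidean_norm v <= 1 -> euclidean_norm (M *m v) <= operator_norm M.
Proof.
move=> v1; apply: ub_le_sup; last by exists v.
exists (Num.sqrt (frob M)) => _ [w /= w1 <-].
rewrite euclidean_normE ler_sqrt ?frob_ge0// (le_trans (frobM _ _))//.
rewrite ler_piMr ?frob_ge0// -[leLHS]sqr_sqrtr ?frob_ge0//.
by rewrite -euclidean_normE expr_le1 // euclidean_normE sqrtr_ge0.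
Qed.

(** Each of the [n] columns of [M] is the image of a unit basis vector. *)
Lemma frob_le_operator_norm (M : 'M[R]_n) (C : R) :
  operator_norm M <= C -> frob M <= n%:R * C ^+ 2.
Proof.
move=> MC; rewrite -frob_tr frob_row -[n in n%:R]card_ord -sum1_card natr_sum.
rewrite mulr_suml; apply: ler_sum => j _; rewrite mul1r.
have e1 : euclidean_norm (delta_mx j 0 : 'cV[R]_n) <= 1.
  rewrite /euclidean_norm (bigD1 j)//= big1 => [|i /negbTE ij]; rewrite mxE.
    by rewrite !eqxx addr0 expr1n sqrtr1.
  by rewrite ij expr0n.
have := le_trans (euclidean_norm_le_operator_norm M e1) MC.
rewrite -colE euclidean_normE -tr_col frob_tr => h.
rewrite -[leLHS]sqr_sqrtr ?frob_ge0// lerXn2r// nnegrE ?sqrtr_ge0//.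
exact: le_trans (sqrtr_ge0 _) h.
Qed.

End OperatorNorm.

(** * Symmetric matrices above the identity with bounded norm *)

Section Tame.
Variables (R : realType) (n : nat).

(** The second condition says that [M] >= Id as a quadratic form; unlike positive definiteness, it
    is closed. *)
Definition tame (c : R) (M : 'M[R]_n) : Prop :=
  [/\ M^T = M, forall u : 'rV_n, frob u <= (u *m M *m u^T) 0 0 & frob M <= c].

Lemma tame_le c c' (M : 'M[R]_n) : c <= c' -> tame c M -> tame c' M.
Proof. by move=> cc' [? ? Mc]; split=> //; apply: le_trans cc'. Qed.

Lemma closed_tame c : closed (tame c).
Proof.
(* Symmetry is written as [frob (M^T - M) <= 0], so that every condition is the preimage of a closed
   half-line. *)
have -> : tame c = [set M | frob (M^T - M) <= 0] `&`
    (\bigcap_(u in [set: 'rV_n]) [set M | frob u <= (u *m M *m u^T) 0 0] `&`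
     [set M | frob M <= c]).
  apply/seteqP; split=> [M [Msym Mpos Mc]|M /= [M0 [Mpos Mc]]].
    split; first by rewrite /= Msym subrr frob0.
    by split=> // u _; exact: Mpos.
  split=> // [|u]; last exact: Mpos.
  apply/eqP; rewrite -subr_eq0; apply/eqP/frob_eq0/le_anti.
  by rewrite M0 frob_ge0.
apply: closedI; [|apply: closedI].
- apply: (@closed_preimage _ _ (fun M : 'M[R]_n => frob (M^T - M))
    [set y | y <= 0]); last exact: closed_le.
  move=> M; apply: (@continuous_comp _ _ _ (fun M => M^T - M) (@frob R n n)).
    apply: continuous_addmx.
      by apply: (@continuous_trmx _ _ _ _ id) => N; apply: cvg_id.
    by apply: (@continuous_oppmx _ _ _ _ id) => N; apply: cvg_id.
  exact: continuous_frob.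
- apply: closed_bigI => u _.
  apply: (@closed_preimage _ _ (fun M : 'M[R]_n => (u *m M *m u^T) 0 0)
    [set y | frob u <= y]); last exact: closed_ge.
  apply: continuous_coord; apply: continuous_mulmx; last exact: cst_continuous.
  by apply: continuous_mulmx => [|M]; [exact: cst_continuous|exact: cvg_id].
- apply: (@closed_preimage _ _ (@frob R n n) [set y | y <= c]).
    exact: continuous_frob.
  exact: closed_le.
Qed.

(** Symmetry and the lower bound are convex conditions; the parallelogram identity improves the norm
    bound. *)
Lemma tame_midpoint c e (p q : 'M[R]_n) :
  e <= frob (p - q) / 4 -> tame c p -> tame c q ->
  tame (c - e) (2^-1 *: (p + q)).
Proof.
move=> epq [psym ppos pc] [qsym qpos qc]; split.
- by rewrite linearZ linearD/= psym qsym.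
- move=> u; rewrite -scalemxAr -scalemxAl mulmxDr mulmxDl !mxE.
  by have := ppos u; have := qpos u; rewrite !mxE; lra.
- by rewrite frob_midpoint; lra.
Qed.

End Tame.

(** The orbit of a point of [Y] stays in [Y]; being dense, it would meet the open complement if that
    were nonempty. *)
Lemma minimal_closed_invariant (G : semigroupType) (X : topologicalType)
    (act : G -> X -> X) (Y : set X) :
  minimal_action act -> closed Y -> Y !=set0 ->
  (forall f y, Y y -> Y (act f y)) -> Y = setT.
Proof.
move=> act_min Ycl [y Yy] Yact; apply/seteqP; split=> // x _.
apply: contrapT => nYx.
have [|z [nYz [f _ fz]]] := act_min y (~` Y) _ (closed_openC Ycl).
  by exists x.
by apply: nYz; rewrite -fz; apply: Yact.
Qed.

(** * The sets K(c) and the invariant section *)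

Section InvariantMetric.
Variables (R : realType) (n : nat) (G : semigroupType) (X : metricType R).
Variables (act : G -> X -> X) (A : G -> X -> 'M[R]_n).
Hypotheses (Xcompact : compact [set: X]).
Hypotheses (act_minimal : minimal_action act) (A_cocycle : GL_cocycle act A).

(** Carries the fibre over [x] to the fibre over [act f x]. *)
Definition push f x (p : 'M[R]_n) : 'M[R]_n := A f x *m p *m (A f x)^T.

(** The set K(c). The point itself is tested apart from its images because [G] may have no unit. *)
Definition tame_along (c : R) : set (X * 'M[R]_n) :=
  [set z | tame c z.2 /\ forall g, tame c (push g z.1 z.2)].

Lemma pushM f g x p : push (f * g)%g x p = push f (act g x) (push g x p).
Proof. by case: A_cocycle => _ _ AM; rewrite /push AM trmx_mul !mulmxA. Qed.

Lemma tame_along_act c f x p :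
  tame_along c (x, p) -> tame_along c (act f x, push f x p).
Proof. by move=> [_ /= tp]; split=> //= g; rewrite -pushM. Qed.

Lemma tame_along_le c c' : c <= c' -> tame_along c `<=` tame_along c'.
Proof.
move=> cc' [x p] [/= tp tpg]; split=> [|g] /=; first exact: tame_le tp.
exact: tame_le (tpg g).
Qed.

Lemma continuous_push g : continuous (fun z : X * 'M[R]_n => push g z.1 z.2).
Proof.
have Agc : continuous (fun z : X * 'M[R]_n => A g z.1).
  case: A_cocycle => Ac _ _ z.
  by apply: (@continuous_comp _ _ _ fst (A g)); [exact: cvg_fst|exact: Ac].
apply: continuous_mulmx; last exact: continuous_trmx.
by apply: continuous_mulmx => // z; exact: cvg_snd.
Qed.

Lemma closed_tame_along c : closed (tame_along c).
Proof.
have -> : tame_along c = [set z | tame c z.2] `&`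
    \bigcap_(g in [set: G]) [set z | tame c (push g z.1 z.2)].
  by apply/seteqP; split=> z [tz tzg]; split=> // g; [move=> _|]; exact: tzg.
apply: closedI; [|apply: closed_bigI => g _].
- apply: (@closed_preimage _ _ (@snd X 'M[R]_n)); last exact: closed_tame.
  by move=> z; exact: cvg_snd.
- apply: (@closed_preimage _ _ (fun z => push g z.1 z.2)).
    exact: continuous_push.
  exact: closed_tame.
Qed.

Lemma compact_tame_along c : compact (tame_along c).
Proof.
have XMc := compact_setX Xcompact (@compact_frob_le R n n c).
apply: subclosed_compact (@closed_tame_along c) XMc _.
by move=> [x p] [[_ _ pc] _]; split.
Qed.

(** The projection of K(c) to [X] is compact, hence closed, and invariant, so minimality applies. *)
Lemma tame_along_surj c : tame_along c !=set0 ->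
  forall x, exists p, tame_along c (x, p).
Proof.
move=> [[y q] cq] x.
have : (fst @` tame_along c) = setT.
  apply: (minimal_closed_invariant act_minimal).
  - apply: compact_closed; first exact: metric_hausdorff.
    apply: continuous_compact; last exact: compact_tame_along.
    by apply: continuous_subspaceT => z; exact: cvg_fst.
  - by exists y, (y, q).
  - move=> f _ [[z p] cp <-]; exists (act f z, push f z p) => //.
    exact: tame_along_act.
by move=> /seteqP[_ /(_ x I)] [[z p] cp /= <-]; exists p.
Qed.

(* Testing [push g x p] against the rows of [A g x]^-1. *)
Lemma tame_along_frob_inv c g x p :
  tame_along c (x, p) -> frob (invmx (A g x)) <= \tr p.
Proof.
move=> [_ /(_ g)/= [_ pos _]]; case: A_cocycle => _ /(_ g x) Au _.
rewrite frob_row; apply: ler_sum => i _; apply: le_trans (pos _) _.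
have rA : row i (invmx (A g x)) *m A g x = delta_mx 0 i.
  by rewrite -row_mul mulVmx// row1.
rewrite /push !mulmxA rA -mulmxA -trmx_mul rA -rowE trmx_delta -colE !mxE.
exact: lexx.
Qed.

(** Undoing the push costs two factors [invmx (A g x)], each bounded through [\tr p] uniformly in
    [g]. Hence the images of two distinct points of a fibre stay uniformly apart. *)
Lemma tame_along_frob_push c g x p d :
  tame_along c (x, p) -> frob d <= (\tr p) ^+ 2 * frob (push g x d).
Proof.
move=> cp; case: A_cocycle => _ /(_ g x) Au _.
have {1}-> : d = invmx (A g x) *m push g x d *m (invmx (A g x))^T.
  by rewrite /push !mulmxA mulVmx// mul1mx -mulmxA -trmx_mul mulVmx//
    trmx1 mulmx1.
have := tame_along_frob_inv g cp; set i := frob (invmx _) => itr.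
have i0 : 0 <= i by exact: frob_ge0.
apply: le_trans (frobM _ _) _; rewrite frob_tr -/i.
apply: (@le_trans _ _ (i * frob (push g x d) * i)).
  by rewrite ler_wpM2r// frobM.
have p0 := frob_ge0 (push g x d).
rewrite mulrAC -expr2 ler_wpM2r// lerXn2r// nnegrE.
exact: le_trans itr.
Qed.

Lemma tame_along_uniq c x p q :
  (forall c', tame_along c' !=set0 -> c <= c') ->
  tame_along c (x, p) -> tame_along c (x, q) -> p = q.
Proof.
move=> cmin cp cq; apply/eqP; rewrite -subr_eq0; apply/eqP/frob_eq0/le_anti.
rewrite frob_ge0 andbT.
(* [T] dominates 1, for the points themselves, and [(\tr p) ^+ 2], for their images, so one [e]
   serves all midpoints. *)
pose T := 1 + (\tr p) ^+ 2; have T1 : 1 <= T by rewrite lerDl sqr_ge0.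
have T0 : 0 < T by apply: lt_le_trans T1.
pose e := frob (p - q) / T / 4.
(* Minimality of [c] then gives [e <= 0], that is, [frob (p - q) <= 0]. *)
suff : tame_along (c - e) !=set0.
  move=> /cmin; rewrite lerBrDr gerDl /e pmulr_lle0 ?invr_gt0//.
  by rewrite pmulr_lle0 ?invr_gt0.
exists (x, 2^-1 *: (p + q)); case: (cp) (cq) => [/= tp tpg] [/= tq tqg].
split=> [|g] /=.
  apply: tame_midpoint => //; rewrite /e ler_pM2r ?invr_gt0//.
  by rewrite ler_pdivrMr// ler_peMr// frob_ge0.
have -> : push g x (2^-1 *: (p + q)) = 2^-1 *: (push g x p + push g x q).
  by rewrite /push -scalemxAr -scalemxAl mulmxDr mulmxDl.
apply: tame_midpoint => //; rewrite /e ler_pM2r ?invr_gt0//.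
have -> : push g x p - push g x q = push g x (p - q).
  by rewrite /push mulmxBr mulmxBl.
rewrite ler_pdivrMr// mulrC (le_trans (tame_along_frob_push g (p - q) cp))//.
by rewrite ler_wpM2r ?frob_ge0// /T lerDr.
Qed.

(** The infimum is attained: a cluster point of points [z k] in K(inf E + 1/(k+1)) lies in K(inf E +
    e) for every e > 0, hence in K(inf E). *)
Lemma tame_along_min c0 : tame_along c0 !=set0 ->
  exists2 c, tame_along c !=set0 & forall c', tame_along c' !=set0 -> c <= c'.
Proof.
move=> ne0; pose E := [set c | tame_along c !=set0].
have Einf : has_inf E.
  split; first by exists c0.
  by exists 0 => c [z [[_ _ pc] _]]; apply: le_trans (frob_ge0 _) pc.
have /choice[z Kz] (k : nat) : exists z, tame_along (inf E + k.+1%:R^-1) z.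
  have [|c [z cz] lec] := @inf_adherent _ E k.+1%:R^-1 _ Einf.
    by rewrite invr_gt0 ltr0n.
  by exists z; apply: tame_along_le cz; apply: ltW.
have evK (e : R) : 0 < e -> \forall k \near \oo, tame_along (inf E + e) (z k).
  move=> e0; near=> k; apply: tame_along_le (Kz k); rewrite lerD2l ltW//.
  by near: k; exact: near_infty_natSinv_lt (PosNum e0).
have [y [_ zy]] := @compact_tame_along _ (z @ \oo) _ (evK _ ltr01).
have Ky (e : R) : 0 < e -> tame_along (inf E + e) y.
  by move=> e0; apply: closed_tame_along => B yB; apply: zy yB; exact: evK.
exists (inf E); last by move=> c'; exact: (ge_inf Einf.2).
(* Only the norm bound depends on the level; the other conditions are read off at e = 1. *)
exists y; have [[ysym ypos _] yg] := Ky _ ltr01.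
split=> [|g].
  by split=> //; apply/ler_addgt0Pr => e e0; case: (Ky _ e0) => -[].
have [gsym gpos _] := yg g.
by split=> //; apply/ler_addgt0Pr => e e0; case: (Ky _ e0) => _ /(_ g)[].
Unshelve. all: by end_near. Qed.

Lemma tame_along_nonempty x0 (b : R) : 0 <= b ->
  (forall f, frob (A f x0) <= b /\ frob (invmx (A f x0)) <= b) ->
  exists c, tame_along c !=set0.
Proof.
(* The witness is [t] times the identity over [x0]: [t >= 1] puts it above Id, and [t >= b] does so
   for its images, since [b] bounds the inverses. *)
move=> b0 Ab; pose t := b + 1.
have t1 : 1 <= t by rewrite lerDr.
have t0 : 0 <= t by apply: le_trans t1.
(* The summand [n%:R] accounts for the point itself and [b ^+ 2] for its images. *)
exists (t ^+ 2 * (n%:R + b ^+ 2)), (x0, t%:M); split=> [|g] /=; split.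
- by rewrite tr_scalar_mx.
- move=> u; rewrite mul_mx_scalar -scalemxAl mxE mulmx_tr_frob.
  by rewrite ler_peMl ?frob_ge0.
- rewrite -scalemx1 frobZ frob1 ler_wpM2l ?sqr_ge0//.
  by rewrite lerDl sqr_ge0.
- by rewrite /push !trmx_mul trmxK tr_scalar_mx mulmxA.
- move=> u.
  have -> : u *m push g x0 t%:M *m u^T =
      t *: ((u *m A g x0) *m (u *m A g x0)^T).
    by rewrite /push mul_mx_scalar trmx_mul -scalemxAl -scalemxAr -scalemxAl
      !mulmxA.
  rewrite mxE mulmx_tr_frob.
  case: A_cocycle => _ /(_ g x0) Au _; have [_ ib] := Ab g.
  have {1}-> : u = u *m A g x0 *m invmx (A g x0) by rewrite mulmxK.
  apply: le_trans (frobM _ _) _; rewrite mulrC ler_wpM2r ?frob_ge0//.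
  by rewrite (le_trans ib)// lerDl.
- rewrite /push mul_mx_scalar -scalemxAl frobZ ler_wpM2l ?sqr_ge0//.
  apply: le_trans (frobM _ _) _; rewrite frob_tr -expr2.
  have [Agb _] := Ab g; apply: (@le_trans _ _ (b ^+ 2)); last by rewrite lerDr.
  by rewrite lerXn2r// nnegrE frob_ge0.
Qed.

Lemma invariant_metric x0 (b : R) : 0 <= b ->
  (forall f, frob (A f x0) <= b /\ frob (invmx (A f x0)) <= b) ->
  exists S : X -> 'M[R]_n, [/\ continuous S, forall x, (S x)^T = S x,
    forall x (u : 'rV_n), frob u <= (u *m S x *m u^T) 0 0
    & forall f x, push f x (S x) = S (act f x)].
Proof.
move=> b0 /(tame_along_nonempty b0)[c0 /tame_along_min[c cne cmin]].
have /choice[S KS] := tame_along_surj cne.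
have SE x p : tame_along c (x, p) -> S x = p.
  exact: tame_along_uniq cmin (KS x).
exists S; split=> [|x|x|f x].
- apply/continuous_closedP => D Dcl.
  (* Closed graph argument: the preimage of a closed set is the projection of a compact part of
     K(c), the graph of [S]. *)
  have -> : S @^-1` D = fst @` (tame_along c `&` [set z | D z.2]).
    apply/seteqP; split=> [x Dx|_ [[x p] [/= /SE Sx Dp] <-]].
      by exists (x, S x).
    by rewrite /preimage/= Sx.
  apply: compact_closed; first exact: metric_hausdorff.
  apply: continuous_compact.
    by apply: continuous_subspaceT => z; exact: cvg_fst.
  apply: compact_closedI; first exact: compact_tame_along.
  by apply: (@closed_preimage _ _ (@snd X 'M[R]_n)) => // z; exact: cvg_snd.
- by case: (KS x) => -[].
- by case: (KS x) => -[].
(* The pushed point lies in the fibre over [act f x], which is a singleton. *)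
- by rewrite (SE _ _ (tame_along_act f (KS x))).
Qed.

End InvariantMetric.

(** * Conjugation into the orthogonal group *)

Theorem theoremA (R : realType) (n : nat) (G : semigroupType)
    (X : metricType R) (act : G -> X -> X) (A : G -> X -> 'M[R]_n)
    (Xcompact : compact [set: X])
    (act_homeo : acts_by_homeomorphisms act)
    (act_minimal : minimal_action act)
    (A_cocycle : GL_cocycle act A)
    (x0 : X) (C : R) (C_gt0 : 0 < C)
    (A_bounded : forall f : G,
        Num.max (operator_norm (A f x0)) (operator_norm (invmx (A f x0))) <= C) :
  exists A' : G -> X -> 'M[R]_n,
    [/\ GL_cocycle act A',
        forall f x, orthogonalmx (A' f x)
      & cohomologous act A A'].
Proof.
have [act_mul act_homeo'] := act_homeo; have [Ac Au AM] := A_cocycle.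
have [||S [Sc Ssym Spos Sinv]] := @invariant_metric _ _ _ _ _ _ Xcompact
    act_minimal A_cocycle x0 (n%:R * C ^+ 2).
- by rewrite mulr_ge0// sqr_ge0.
- by move=> f; have := A_bounded f; rewrite ge_max => /andP[*];
    split; exact: frob_le_operator_norm.
have [|B [B' [Bc B'c BB' BBt]]] := continuous_cholesky Sc Ssym _.
  move=> x u u0; apply: lt_le_trans (Spos x u).
  rewrite lt_neqAle frob_ge0 andbT eq_sym.
  by apply: contraNneq u0 => /frob_eq0 ->.
have Bu x : B x \in unitmx by case: (mulmx1_unit (BB' x)).
(* This identification makes the inverse of [B] continuous. *)
have BV x : invmx (B x) = B' x by rewrite -[LHS]mulmx1 -(BB' x) mulKmx.
pose A' f x := invmx (B (act f x)) *m A f x *m B x.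
have A'u f x : A' f x \in unitmx by rewrite !unitmx_mul unitmx_inv !Bu Au.
exists A'; split.
- split=> // [f|f g x].
  + have [fc _] := act_homeo' f.
    apply: continuous_mulmx => //; apply: continuous_mulmx => //.
    under eq_fun do rewrite BV.
    move=> x; apply: (@continuous_comp _ _ _ (act f) B'); first exact: fc.
    exact: B'c.
  + by rewrite /A' AM act_mul !mulmxA mulmxK.
(* With [S] = B B^T, the product of [A' f x] and its transpose is the push of [S x], which is
   [S (act f x)], conjugated by [B (act f x)] to the identity. *)
- move=> f x; apply: mulmx1C.
  rewrite /A' !trmx_mul !mulmxA -[_ *m B x *m _]mulmxA BBt.
  rewrite -[_ *m A f x *m _]mulmxA -[_ *m _ *m (A f x)^T]mulmxA.
  rewrite [A f x *m _ *m _]Sinv -BBt !mulmxA mulVmx// mul1mx.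
  by rewrite -trmx_mul mulVmx// trmx1.
- by exists B.
Qed.
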